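(* Let $H$ be a Hopf algebra over a field $\Bbbk$ and let $B=A^{\mathrm{co}H}\subseteq A$ be an arbitrary Hopf--Galois extension with translation map $\tau\colon H\to A\otimes_BA$, $\tau(h)=h^{\langle1\rangle}\otimes_Bh^{\langle2\rangle}$. Set $$\mathfrak{X}_\sigma(A):=\{X\in\mathrm{End}_B(A)\mid X(aa')=X(a)a'+X\big(a_0a'(a_1)^{\langle1\rangle}\big)(a_1)^{\langle2\rangle}\ \text{for all }a,a'\in A\}$$ and let $\mathscr{L}\colon\mathfrak{X}_\sigma(A)\to\mathrm{End}_\Bbbk(A)$ be the canonical injection $X\mapsto X$. Then $(\mathfrak{X}_\sigma(A),\mathscr{L})$ is a first order vector field calculus on $A$, where the $A$-bimodule structure of $\mathfrak{X}_\sigma(A)$ is given by $(a\cdot X)(a'):=aX(a')$ and $(X\cdot a)(a'):=X\big(a_0a'(a_1)^{\langle1\rangle}\big)(a_1)^{\langle2\rangle}$ for all $a,a'\in A$ and $X\in\mathfrak{X}_\sigma(A)$.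
   Context: A Hopf--Galois extension is a right $H$-comodule algebra $A$ (algebra with a right $H$-coaction $\Delta_A(a)=a_0\otimes a_1$ that is an algebra map) with coinvariant subalgebra $B=A^{\mathrm{co}H}=\{a\in A\mid\Delta_A(a)=a\otimes1\}$ such that $\chi\colon A\otimes_BA\to A\otimes H$, $a\otimes_Ba'\mapsto aa'_0\otimes a'_1$, is bijective; the translation map is $\tau(h)=\chi^{-1}(1\otimes h)$. $\mathrm{End}_B(A)=\{X\in\mathrm{End}_\Bbbk(A)\mid X(ab)=X(a)b\ \forall a\in A,b\in B\}$ denotes the right $B$-linear endomorphisms. A first order vector field calculus (FOVC) on an associative unital algebra $A$ is a pair $(\mathfrak{X},\mathscr{L})$ where $\mathfrak{X}$ is an $A$-bimodule and $\mathscr{L}\colon\mathfrak{X}\to\mathrm{End}_\Bbbk(A)$ is $\Bbbk$-linear, injective, left $A$-linear ($\mathscr{L}_{a\cdot X}(b)=a\mathscr{L}_X(b)$) and satisfies $\mathscr{L}_X(ab)=\mathscr{L}_X(a)b+\mathscr{L}_{X\cdot a}(b)$ for all $X\in\mathfrak{X}$, $a,b\in A$. *)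

(* Defs.v *)
From HB Require Import structures.
From mathcomp Require Import all_boot all_algebra.
From mathcomp Require Import boolp classical_sets functions.

Set Implicit Arguments.
Unset Strict Implicit.
Unset Printing Implicit Defensive.

Import GRing.Theory.
Local Open Scope ring_scope.
Local Open Scope quotient_scope.

(* Given operators [rho j] on M and [lam j] on N indexed by [j : J], the tensor
   product is the quotient of the formal sums [:: (m1, n1); ...; (mr, nr)],
   read as m1 (x) n1 + ... + mr (x) nr, by the smallest k-linear congruence
   making (x) k-bilinear and balanced: rho j m (x) n = m (x) lam j n. *)
Section Tensor.
Variables (k : fieldType) (M N : lmodType k) (J : Type).
Variables (rho : J -> M -> M) (lam : J -> N -> N).

Definition fsum_scale (c : k) (s : seq (M * N)) : seq (M * N) :=
  [seq (c *: p.1, p.2) | p <- s].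

Inductive tens_rel : seq (M * N) -> seq (M * N) -> Prop :=
| tens_rel_refl s : tens_rel s s
| tens_rel_sym s t : tens_rel s t -> tens_rel t s
| tens_rel_trans s t u : tens_rel s t -> tens_rel t u -> tens_rel s u
| tens_rel_cat s s' t t' :
    tens_rel s s' -> tens_rel t t' -> tens_rel (s ++ t) (s' ++ t')
| tens_rel_scale c s t :
    tens_rel s t -> tens_rel (fsum_scale c s) (fsum_scale c t)
| tens_rel_comm s t : tens_rel (s ++ t) (t ++ s)
| tens_rel_0 n : tens_rel [:: (0, n)] [::]
| tens_rel_addl m m' n : tens_rel [:: (m + m', n)] [:: (m, n); (m', n)]
| tens_rel_addr m n n' : tens_rel [:: (m, n + n')] [:: (m, n); (m, n')]
| tens_rel_scaler c m n : tens_rel [:: (c *: m, n)] [:: (m, c *: n)]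
| tens_rel_bal j m n : tens_rel [:: (rho j m, n)] [:: (m, lam j n)].

Definition tens_eqb (s t : seq (M * N)) : bool := `[< tens_rel s t >].

Fact tens_eqb_refl : reflexive tens_eqb.
Proof. by move=> s; apply/asboolP; exact: tens_rel_refl. Qed.

Fact tens_eqb_sym : symmetric tens_eqb.
Proof. by move=> s t; apply/asboolP/asboolP; exact: tens_rel_sym. Qed.

Fact tens_eqb_trans : transitive tens_eqb.
Proof.
by move=> t s u /asboolP st /asboolP tu; apply/asboolP; exact: tens_rel_trans tu.
Qed.

Canonical tens_equiv :=
  EquivRel tens_eqb tens_eqb_refl tens_eqb_sym tens_eqb_trans.

Definition tensor := {eq_quot tens_equiv}.

HB.instance Definition _ := Choice.on tensor.
HB.instance Definition _ := EqQuotient.on tensor.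

Definition tens (m : M) (n : N) : tensor := \pi_tensor [:: (m, n)].

Lemma pi_tensP s t : tens_rel s t <-> \pi_tensor s = \pi_tensor t.
Proof.
split=> [st|/eqmodP/asboolP//].
by apply/eqmodP/asboolP.
Qed.

Lemma tens_rel_repr s : tens_rel (repr (\pi_tensor s)) s.
Proof. by apply/pi_tensP; rewrite reprK. Qed.

Definition tens_zero : tensor := \pi_tensor [::].
Definition tens_add (x y : tensor) : tensor := \pi_tensor (repr x ++ repr y).
Definition tens_scale (c : k) (x : tensor) : tensor :=
  \pi_tensor (fsum_scale c (repr x)).
Definition tens_opp (x : tensor) : tensor := tens_scale (-1) x.

Lemma tens_add_pi s t :
  tens_add (\pi_tensor s) (\pi_tensor t) = \pi_tensor (s ++ t).
Proof. by apply/pi_tensP; apply: tens_rel_cat; exact: tens_rel_repr. Qed.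

Lemma tens_scale_pi c s :
  tens_scale c (\pi_tensor s) = \pi_tensor (fsum_scale c s).
Proof. by apply/pi_tensP; apply: tens_rel_scale; exact: tens_rel_repr. Qed.

Fact tens_addA : associative tens_add.
Proof.
move=> x y z; rewrite -[x]reprK -[y]reprK -[z]reprK.
move: (repr x) (repr y) (repr z) => s t u.
by rewrite (tens_add_pi s t) (tens_add_pi t u) !tens_add_pi catA.
Qed.

Fact tens_addC : commutative tens_add.
Proof. by move=> x y; apply/pi_tensP; exact: tens_rel_comm. Qed.

Fact tens_add0 : left_id tens_zero tens_add.
Proof. by move=> x; rewrite -[x]reprK tens_add_pi. Qed.

Fact tens_scaleDl x c d :
  tens_scale (c + d) x = tens_add (tens_scale c x) (tens_scale d x).
Proof.
rewrite -[x]reprK !tens_scale_pi tens_add_pi; apply/pi_tensP.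
elim: (repr x) => [|[m n] s IHs] /=; first exact: tens_rel_refl.
rewrite scalerDl -cat1s.
apply: tens_rel_trans (tens_rel_cat (tens_rel_addl _ _ _) IHs) _ => /=.
rewrite -cat1s -[X in tens_rel _ X]cat1s.
apply: tens_rel_cat; first exact: tens_rel_refl.
rewrite -cat1s -[X in tens_rel _ (_ ++ X)]cat1s !catA.
by apply: tens_rel_cat; [exact: tens_rel_comm | exact: tens_rel_refl].
Qed.

Fact tens_scale0 x : tens_scale 0 x = tens_zero.
Proof.
rewrite -[x]reprK tens_scale_pi; apply/pi_tensP.
elim: (repr x) => [|[m n] s IHs] /=; first exact: tens_rel_refl.
by rewrite scale0r -cat1s; apply: (tens_rel_cat (tens_rel_0 _) IHs).
Qed.

Fact tens_scale1 : left_id 1 tens_scale.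
Proof.
move=> x; rewrite -[RHS]reprK; congr (\pi_tensor _).
by elim: (repr x) => //= -[m n] s ->; rewrite scale1r.
Qed.

Fact tens_scaleA c d x : tens_scale c (tens_scale d x) = tens_scale (c * d) x.
Proof.
rewrite -[x]reprK (tens_scale_pi d) !tens_scale_pi.
congr (\pi_tensor _).
by elim: (repr x) => //= -[m n] s ->; rewrite scalerA.
Qed.

Fact tens_scaleDr : right_distributive tens_scale tens_add.
Proof.
move=> c x y; rewrite -[x]reprK -[y]reprK.
move: (repr x) (repr y) => s t.
by rewrite (tens_add_pi s t) !tens_scale_pi tens_add_pi /fsum_scale map_cat.
Qed.

Fact tens_addN : left_inverse tens_zero tens_opp tens_add.
Proof.
move=> x; rewrite -[in X in tens_add _ X](tens_scale1 x) -tens_scaleDl addNr.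
exact: tens_scale0.
Qed.

HB.instance Definition _ :=
  GRing.isZmodule.Build tensor tens_addA tens_addC tens_add0 tens_addN.
HB.instance Definition _ :=
  GRing.Zmodule_isLmodule.Build k tensor
    tens_scaleA tens_scale1 tens_scaleDr (fun x c d => tens_scaleDl x c d).

Lemma tensDl m m' n : tens (m + m') n = tens m n + tens m' n.
Proof.
by rewrite [RHS]tens_add_pi; apply/pi_tensP; exact: tens_rel_addl.
Qed.

Lemma tensDr m n n' : tens m (n + n') = tens m n + tens m n'.
Proof.
by rewrite [RHS]tens_add_pi; apply/pi_tensP; exact: tens_rel_addr.
Qed.

Lemma tensZl c m n : tens (c *: m) n = c *: tens m n.
Proof. by rewrite [RHS]tens_scale_pi. Qed.

Lemma tensZr c m n : tens m (c *: n) = c *: tens m n.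
Proof. by rewrite -tensZl; apply/esym/pi_tensP; exact: tens_rel_scaler. Qed.

Lemma tens_bal j m n : tens (rho j m) n = tens m (lam j n).
Proof. by apply/pi_tensP; exact: tens_rel_bal. Qed.

Lemma tens_pi s : \pi_tensor s = \sum_(p <- s) tens p.1 p.2.
Proof.
elim: s => [|[m n] s IHs]; first by rewrite big_nil.
by rewrite big_cons -IHs [RHS]tens_add_pi.
Qed.

Lemma tensE (x : tensor) : x = \sum_(p <- repr x) tens p.1 p.2.
Proof. by rewrite -tens_pi reprK. Qed.

Lemma tens_ind (P : tensor -> Prop) :
  P 0 -> (forall m n, P (tens m n)) -> (forall x y, P x -> P y -> P (x + y)) ->
  forall x, P x.
Proof.
by move=> P0 Pt PD x; rewrite (tensE x); elim/big_ind: _ => // p _.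
Qed.

(* Sums over the components of a tensor: if x = m1 (x) n1 + ... + mr (x) nr
    then [tlift f x] is f m1 n1 + ... + f mr nr. The value is independent of the
    presentation of x whenever f is bilinear and balanced ([tliftE] and
    [tlift_linear]). *)
Definition tlift (P : zmodType) (f : M -> N -> P) (x : tensor) : P :=
  \sum_(p <- repr x) f p.1 p.2.

Record balanced_bilinear (P : lmodType k) (f : M -> N -> P) : Prop :=
  BalancedBilinear {
    bb_linearl : forall n, linear (f^~ n);
    bb_linearr : forall m, linear (f m);
    bb_bal : forall j m n, f (rho j m) n = f m (lam j n) }.

Lemma tlift_pi (P : lmodType k) (f : M -> N -> P) s : balanced_bilinear f ->
  tlift f (\pi_tensor s) = \sum_(p <- s) f p.1 p.2.
Proof.
move=> [fl fr fb]; rewrite /tlift.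
have f0 n : f 0 n = 0.
  by have := fl n (-1) 0 0; rewrite scaleN1r oppr0 addr0 scaleN1r addNr.
have fD m m' n : f (m + m') n = f m n + f m' n.
  by have := fl n 1 m m'; rewrite !scale1r.
have fZ c m n : f (c *: m) n = c *: f m n.
  by have := fl n c m 0; rewrite !addr0 f0 addr0.
have fD' m n n' : f m (n + n') = f m n + f m n'.
  by have := fr m 1 n n'; rewrite !scale1r.
have f0' m : f m 0 = 0 by apply: (addrI (f m 0)); rewrite -fD' !addr0.
have fZ' c m n : f m (c *: n) = c *: f m n.
  by have := fr m c n 0; rewrite !addr0 f0' addr0.
suff key u t : tens_rel u t ->
    \sum_(p <- u) f p.1 p.2 = \sum_(p <- t) f p.1 p.2.
  exact/key/tens_rel_repr.
elim=> {s u t} //.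
- by move=> s t u _ -> _ ->.
- by move=> s s' t t' _ IH1 _ IH2; rewrite !big_cat /= IH1 IH2.
- move=> c s t _ IH; rewrite !big_map /=.
  under eq_bigr do rewrite fZ.
  under [RHS]eq_bigr do rewrite fZ.
  by rewrite -!scaler_sumr IH.
- by move=> s t; rewrite !big_cat /= addrC.
- by move=> n; rewrite big_seq1 big_nil f0.
- by move=> m m' n; rewrite big_seq1 !big_cons big_nil addr0 fD.
- by move=> m n n'; rewrite big_seq1 !big_cons big_nil addr0 fD'.
- by move=> c m n; rewrite !big_seq1 fZ fZ'.
- by move=> j m n; rewrite !big_seq1 fb.
Qed.

Lemma tliftE (P : lmodType k) (f : M -> N -> P) m n : balanced_bilinear f ->
  tlift f (tens m n) = f m n.
Proof. by move=> bf; rewrite tlift_pi// big_seq1. Qed.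

Lemma tlift_linear (P : lmodType k) (f : M -> N -> P) : balanced_bilinear f ->
  linear (tlift f).
Proof.
move=> bf c x y; have [fl _ _] := bf.
rewrite -[x]reprK -[y]reprK.
have -> : c *: \pi_tensor (repr x) + \pi_tensor (repr y) =
    \pi_tensor (fsum_scale c (repr x) ++ repr y).
  by rewrite -tens_add_pi -tens_scale_pi.
rewrite !tlift_pi// big_cat/= big_map/= scaler_sumr; congr (_ + _).
apply: eq_bigr => -[m n] _ /=.
have f0 : f 0 n = 0.
  by have := fl n (-1) 0 0; rewrite scaleN1r oppr0 addr0 scaleN1r addNr.
by have := fl n c m 0; rewrite !addr0 f0 addr0.
Qed.

End Tensor.

Arguments tens {k M N J rho lam} m n.
Arguments tlift {k M N J rho lam P} f x.
Arguments tens_ind : clear implicits.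


Notation tensork M N :=
  (tensor (fun c (m : M) => c *: m) (fun c (n : N) => c *: n)).

Notation "M ⊗ N" := (tensork M N) (at level 40, left associativity) : type_scope.
Notation "m ⊗ n" := (tens m n) (at level 40, left associativity) : ring_scope.

Lemma bilinear_balanced (k : fieldType) (M N P : lmodType k) (f : M -> N -> P) :
  (forall n, linear (f^~ n)) -> (forall m, linear (f m)) ->
  balanced_bilinear (fun c (m : M) => c *: m) (fun c (n : N) => c *: n) f.
Proof.
move=> fl fr; split=> // c m n.
have f0 : f 0 n = 0.
  by have := fl n (-1) 0 0; rewrite scaleN1r oppr0 addr0 scaleN1r addNr.
have f0' : f m 0 = 0.
  by have := fr m (-1) 0 0; rewrite scaleN1r oppr0 addr0 scaleN1r addNr.
by rewrite -[c *: m]addr0 fl f0 -[c *: n in RHS]addr0 fr f0'.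
Qed.

Definition tmap (k : fieldType) (M N M' N' : lmodType k)
    (f : M -> M') (g : N -> N') : M ⊗ N -> M' ⊗ N' :=
  tlift (fun m n => f m ⊗ g n).

Definition tassoc (k : fieldType) (M N P : lmodType k) :
    (M ⊗ N) ⊗ P -> M ⊗ (N ⊗ P) :=
  tlift (fun x p => tlift (fun m n => m ⊗ (n ⊗ p)) x).

Section TensorAlgebra.
Variables (k : fieldType) (A B : algType k).
Implicit Types x y z : A ⊗ B.

Definition tmul x y : A ⊗ B :=
  tlift (fun a b => tlift (fun a' b' => (a * a') ⊗ (b * b')) y) x.

Let innerP (a : A) (b : B) :
  balanced_bilinear (fun c (m : A) => c *: m) (fun c (n : B) => c *: n)
    (fun a' b' => (a * a') ⊗ (b * b') : A ⊗ B).
Proof.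
apply: bilinear_balanced => [b' c u v|a' c u v].
  by rewrite mulrDr -scalerAr tensDl tensZl.
by rewrite mulrDr -scalerAr tensDr tensZr.
Qed.

Let outerP y :
  balanced_bilinear (fun c (m : A) => c *: m) (fun c (n : B) => c *: n)
    (fun a b => tlift (fun a' b' => (a * a') ⊗ (b * b') : A ⊗ B) y).
Proof.
apply: bilinear_balanced => [b c u v|a c u v].
  rewrite /tlift scaler_sumr -big_split; apply: eq_bigr => p _ /=.
  by rewrite mulrDl -scalerAl tensDl tensZl.
rewrite /tlift scaler_sumr -big_split; apply: eq_bigr => p _ /=.
by rewrite mulrDl -scalerAl tensDr tensZr.
Qed.

Lemma tmulE (a a' : A) (b b' : B) :
  tmul (a ⊗ b) (a' ⊗ b') = (a * a') ⊗ (b * b').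
Proof. by rewrite /tmul (tliftE _ _ (outerP _)) (tliftE _ _ (innerP _ _)). Qed.

Fact tmulDl : left_distributive tmul +%R.
Proof.
by move=> x y z; have := tlift_linear (outerP z) 1 x y; rewrite !scale1r.
Qed.

Fact tmulDr : right_distributive tmul +%R.
Proof.
move=> x y z; rewrite {1}/tmul /tlift -big_split; apply: eq_bigr => p _ /=.
by have := tlift_linear (innerP p.1 p.2) 1 y z; rewrite !scale1r.
Qed.

Fact tmulA : associative tmul.
Proof.
have m0l z : tmul 0 z = 0 by apply: (addrI (tmul 0 z)); rewrite -tmulDl !addr0.
have m0r z : tmul z 0 = 0 by apply: (addrI (tmul z 0)); rewrite -tmulDr !addr0.
move=> x y z.
elim/tens_ind: x => [|a b|u v IHu IHv]; [by rewrite !m0l| |by rewrite !tmulDl IHu IHv].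
elim/tens_ind: y => [|a' b'|u v IHu IHv];
  [by rewrite m0l !m0r m0l| |by rewrite tmulDl !tmulDr tmulDl IHu IHv].
elim/tens_ind: z => [|a'' b''|u v IHu IHv];
  [by rewrite !m0r| |by rewrite !tmulDr IHu IHv].
by rewrite !tmulE !mulrA.
Qed.

Fact tmul1 : left_id (1 ⊗ 1) tmul.
Proof.
move=> x; elim/tens_ind: x => [|a b|u v IHu IHv].
- by apply: (addrI (tmul (1 ⊗ 1) 0)); rewrite -tmulDr !addr0.
- by rewrite tmulE !mul1r.
- by rewrite tmulDr IHu IHv.
Qed.

Fact tmulr1 : right_id (1 ⊗ 1) tmul.
Proof.
move=> x; elim/tens_ind: x => [|a b|u v IHu IHv].
- by apply: (addrI (tmul 0 (1 ⊗ 1))); rewrite -tmulDl !addr0.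
- by rewrite tmulE !mulr1.
- by rewrite tmulDl IHu IHv.
Qed.

HB.instance Definition _ := GRing.Zmodule_isPzRing.Build (A ⊗ B)%type
  tmulA tmul1 tmulr1 tmulDl tmulDr.

End TensorAlgebra.

HB.mixin Record isHopfAlgebra (k : fieldType) H of GRing.Algebra k H := {
  comul : {linear H -> (H ⊗ H)%type};
  counit : {scalar H};
  antipode : {linear H -> H};
  comulA : forall x : H,
    tassoc (tmap comul idfun (comul x)) = tmap idfun comul (comul x);
  counit_comul : forall x : H,
    tlift (fun h1 h2 : H => counit h1 *: h2) (comul x) = x;
  comul_counit : forall x : H,
    tlift (fun h1 h2 : H => counit h2 *: h1) (comul x) = x;
  comul_monoid_morphism : monoid_morphism comul;
  counit_monoid_morphism : monoid_morphism counit;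
  antipode_comul : forall x : H,
    tlift (fun h1 h2 : H => antipode h1 * h2) (comul x) = (counit x)%:A;
  comul_antipode : forall x : H,
    tlift (fun h1 h2 : H => h1 * antipode h2) (comul x) = (counit x)%:A
}.

#[short(type="hopfAlgType")]
HB.structure Definition HopfAlgebra (k : fieldType) :=
  {H of GRing.Algebra k H & isHopfAlgebra k H}.

Section HopfGalois.
Variables (k : fieldType) (H : hopfAlgType k) (A : algType k).
Variable (delta : {linear A -> (A ⊗ H)%type}).

Record comodule_algebra : Prop := ComoduleAlgebra {
  coactA : forall a : A,
    tassoc (tmap delta idfun (delta a)) = tmap idfun comul (delta a);
  coact_counit : forall a : A,
    tlift (fun (a0 : A) (a1 : H) => counit a1 *: a0) (delta a) = a;
  coact_monoid_morphism : monoid_morphism delta }.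

(* This is B = A^{co H}. *)
Definition coinvariant : set A := [set a | delta a = a ⊗ 1].

(* This is A ⊗_B A; k-balancedness is built into [tensor]. *)
Definition tensorB := tensor
  (fun (b : coinvariant) (a : A) => a * val b)
  (fun (b : coinvariant) (a : A) => val b * a).
HB.instance Definition _ := GRing.Lmodule.on tensorB.

(* chi (a ⊗_B a') = a a'_0 ⊗ a'_1. *)
Definition canonical_map (t : tensorB) : A ⊗ H :=
  tlift (fun a a' => tlift (fun a'0 a'1 => (a * a'0) ⊗ a'1) (delta a')) t.

Definition Hopf_Galois : Prop := comodule_algebra /\ bijective canonical_map.

(* The inverse of the canonical map when the latter is bijective. *)
Definition translation_map (h : H) : tensorB :=
  'pinv_(fun=> 0) setT canonical_map (1 ⊗ h).

End HopfGalois.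

Section Endomorphisms.
Variables (k : fieldType) (V : lmodType k).

Definition Endk := {linear V -> V}.

HB.instance Definition _ := gen_eqMixin Endk.
HB.instance Definition _ := gen_choiceMixin Endk.

Lemma Endk_eqP (X Y : Endk) : (forall v, X v = Y v) -> X = Y.
Proof.
case: X Y => [f cf] [g cg] fg; have {}fg : f = g by apply: funext.
case: _ / fg cg => cg; congr GRing.Linear.Pack.
case: cf cg => [[fa] [fs]] [[ga] [gs]].
by congr GRing.Linear.Class; f_equal; exact: Prop_irrelevance.
Qed.

Definition Endk_zero : Endk := (\0 : {linear V -> V}).
Definition Endk_add (X Y : Endk) : Endk :=
  ((X : {linear V -> V}) \+ (Y : {linear V -> V}) : {linear V -> V}).
Definition Endk_opp (X : Endk) : Endk :=
  (\- (X : {linear V -> V}) : {linear V -> V}).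
Definition Endk_scale (c : k) (X : Endk) : Endk :=
  (c \*: (X : {linear V -> V}) : {linear V -> V}).

Fact Endk_addA : associative Endk_add.
Proof. by move=> X Y Z; apply: Endk_eqP => v; exact: addrA. Qed.
Fact Endk_addC : commutative Endk_add.
Proof. by move=> X Y; apply: Endk_eqP => v; exact: addrC. Qed.
Fact Endk_add0 : left_id Endk_zero Endk_add.
Proof. by move=> X; apply: Endk_eqP => v; exact: add0r. Qed.
Fact Endk_addN : left_inverse Endk_zero Endk_opp Endk_add.
Proof. by move=> X; apply: Endk_eqP => v; exact: addNr. Qed.

HB.instance Definition _ :=
  GRing.isZmodule.Build Endk Endk_addA Endk_addC Endk_add0 Endk_addN.

Fact Endk_scaleA c d X : Endk_scale c (Endk_scale d X) = Endk_scale (c * d) X.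
Proof. by apply: Endk_eqP => v; exact: scalerA. Qed.
Fact Endk_scale1 : left_id 1 Endk_scale.
Proof. by move=> X; apply: Endk_eqP => v; exact: scale1r. Qed.
Fact Endk_scaleDr : right_distributive Endk_scale +%R.
Proof. by move=> c X Y; apply: Endk_eqP => v; exact: scalerDr. Qed.
Fact Endk_scaleDl X : {morph Endk_scale^~ X : c d / c + d}.
Proof. by move=> c d; apply: Endk_eqP => v; exact: scalerDl. Qed.

HB.instance Definition _ := GRing.Zmodule_isLmodule.Build k Endk
  Endk_scaleA Endk_scale1 Endk_scaleDr Endk_scaleDl.

Lemma Endk_linearE (c : k) (X Y : Endk) v : (c *: X + Y) v = c *: X v + Y v.
Proof. by []. Qed.

End Endomorphisms.

Section VectorFieldCalculus.
Variables (k : fieldType) (A : algType k) (V : lmodType k).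
Variables (lact : A -> V -> V) (ract : V -> A -> V).

(* Bilinearity makes both actions of the scalars A ∋ c 1 agree with the vector
   space structure of V. *)
Record is_bimodule : Prop := IsBimodule {
  lact_linearl : forall X, linear (lact^~ X);
  lact_linearr : forall a, linear (lact a);
  lactA : forall a b X, lact (a * b) X = lact a (lact b X);
  lact1 : forall X, lact 1 X = X;
  ract_linearl : forall a, linear (ract^~ a);
  ract_linearr : forall X, linear (ract X);
  ractA : forall X a b, ract X (a * b) = ract (ract X a) b;
  ract1 : forall X, ract X 1 = X;
  lract : forall a X b, ract (lact a X) b = lact a (ract X b) }.

Record is_FOVC (L : V -> Endk A) : Prop := IsFOVC {
  fovc_bimodule : is_bimodule;
  fovc_linear : linear L;
  fovc_inj : injective L;
  fovc_lact : forall a X b, L (lact a X) b = a * L X b;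
  fovc_leibniz : forall X a b, L X (a * b) = L X a * b + L (ract X a) b }.

End VectorFieldCalculus.

Section BraidedVectorFields.
Variables (k : fieldType) (H : hopfAlgType k) (A : algType k).
Variable delta : {linear A -> (A ⊗ H)%type}.

Definition EndB : set (Endk A) :=
  [set X | forall a b, coinvariant delta b -> X (a * b) = X a * b].

(* This is X(a_0 a' a_1^<1>) a_1^<2>, where a_0 ⊗ a_1 = delta a and
   h^<1> ⊗_B h^<2> = translation_map delta h. The inner sum is balanced over B
   only when X is right B-linear; the definition is meaningful for X in [EndB],
   for delta Hopf-Galois. *)
Definition braided_ract (X : A -> A) (a a' : A) : A :=
  tlift (fun a0 a1 =>
    tlift (fun p q => X (a0 * a' * p) * q) (translation_map delta a1)) (delta a).

Definition Xsigma_set : set (Endk A) :=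
  [set X | EndB X /\
    forall a a', X (a * a') = X a * a' + braided_ract X a a'].

Definition Xsigma_pred : {pred Endk A} := mem Xsigma_set.

Definition Xsigma := {X : Endk A | X \in Xsigma_pred}.

Fact Xsigma_submod_closed : submod_closed Xsigma_pred.
Proof.
split=> [|c X Y]; rewrite !unfold_in !inE.
  split=> [a b _|a a']; first by rewrite /= mul0r.
  rewrite /braided_ract /tlift big1 => [|p _]; first by rewrite /= mul0r addr0.
  by rewrite big1 // => q _; rewrite /= mul0r.
move=> [XB Xt] [YB Yt]; split=> [a b Bb|a a'].
  by rewrite !Endk_linearE XB// YB// mulrDl scalerAl.
rewrite !Endk_linearE Xt Yt.
move: (c *: X + Y) (Endk_linearE c X Y) => Z ZE.
have -> : braided_ract Z a a' =
    c *: braided_ract X a a' + braided_ract Y a a'.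
  rewrite /braided_ract /tlift scaler_sumr -big_split; apply: eq_bigr => p _.
  rewrite /= scaler_sumr -big_split; apply: eq_bigr => q _ /=.
  by rewrite ZE mulrDl scalerAl.
by rewrite scalerDr mulrDl -scalerAl addrACA.
Qed.

HB.instance Definition _ :=
  GRing.isSubmodClosed.Build k (Endk A) Xsigma_pred Xsigma_submod_closed.
HB.instance Definition _ := SubChoice.on Xsigma.
HB.instance Definition _ := [SubChoice_isSubLmodule of Xsigma by <:].

Definition Xsigma_incl (X : Xsigma) : Endk A := val X.

End BraidedVectorFields.

(* Main.v *)
Require Import Defs.
From HB Require Import structures.
From mathcomp Require Import all_boot all_algebra.
From mathcomp Require Import boolp classical_sets functions.

Set Implicit Arguments.
Unset Strict Implicit.
Unset Printing Implicit Defensive.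

Import GRing.Theory.
Local Open Scope ring_scope.

(** The defining condition of X_sigma(A) says that the right action is
    (X . a)(z) = X(a z) - X(a) z. In this form the Leibniz rule is immediate,
    every bimodule axiom but the unit one is a one-line cancellation, and
    X . a is plainly k-linear and right B-linear. Two points use the
    Hopf-Galois structure.

    - X . 1 = X amounts to X(1) = 0. The braided formula gives X . 1 = X, as
      delta 1 = 1 ⊗ 1 and tau 1 = 1 ⊗ 1 ([braided_ract1]), and the Leibniz
      rule at a = z = 1 then forces X(1) = 0 ([Xsigma1]).
    - X . a satisfies the condition again. Writing that condition out, this is
      the identity (X . a) . b = X . (a b) with both sides given by the braided
      formula ([braided_ractM]), so the difference formula is of no help for
      the outer action of b. As delta is multiplicative, the identity follows
      from the anti-multiplicativity of the translation map
        tau (h g) = g^<1> h^<1> ⊗ h^<2> g^<2>     ([translation_mapM]),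
      which is checked after applying the injective map chi:
        g^<1> h^<1> h^<2>_0 g^<2>_0 ⊗ h^<2>_1 g^<2>_1 = 1 ⊗ h g.

    Two devices keep the tensor computations short. First, chi (p ⊗ q) is the
    product (p ⊗ 1) * delta q in the algebra A ⊗ H ([canonical_map_tens]).
    Second, tau h is always expanded along one chosen presentation, so that the
    formula for tau (h g) makes sense although multiplying inside A ⊗_B A is
    not well defined in general. Right B-linearity of X is what makes
    p ⊗ q |-> X (c p) q balanced over B, hence insensitive to that choice. *)

(** * Linear and bilinear maps on tensor products *)

Lemma linear_fun_sum (k : fieldType) (U V : lmodType k) (f : U -> V)
    (I : Type) (r : seq I) (F : I -> U) :
  linear f -> f (\sum_(i <- r) F i) = \sum_(i <- r) f (F i).
Proof.
move=> fL; apply: (big_morph f) => [x y|].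
  by have := fL 1 x y; rewrite !scale1r.
by have := fL (-1) 0 0; rewrite scaleN1r oppr0 addr0 scaleN1r addNr.
Qed.

Lemma tlift_mul (k : fieldType) (A B : algType k) (P : lmodType k)
    (f : A -> B -> P) (x y : (A ⊗ B)%type) :
  balanced_bilinear (fun c (m : A) => c *: m) (fun c (n : B) => c *: n) f ->
  tlift f (x * y) = tlift (fun a b => tlift (fun a' b' => f (a * a') (b * b')) y) x.
Proof.
move=> fb; have fL := tlift_linear fb.
rewrite {1}(tensE x) {1}(tensE y) mulr_suml (linear_fun_sum _ _ fL).
apply: eq_bigr => p _; rewrite mulr_sumr (linear_fun_sum _ _ fL).
by apply: eq_bigr => q _; rewrite [_ * _]tmulE tliftE.
Qed.

Lemma tlift_mull (k : fieldType) (A B : algType k) (a : A) (y : (A ⊗ B)%type) :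
  tlift (fun a' b' => (a * a') ⊗ b' : (A ⊗ B)%type) y = (a ⊗ 1) * y.
Proof.
rewrite {2}(tensE y) mulr_sumr; apply: eq_bigr => p _.
by rewrite [RHS]tmulE mul1r.
Qed.

Lemma tens1_mul_linear (k : fieldType) (A B : algType k) (a : A) :
  linear (fun y : (A ⊗ B)%type => (a ⊗ 1) * y).
Proof.
move=> c x y; rewrite -!tlift_mull; apply: tlift_linear.
apply: bilinear_balanced => [b d u v|a' d u v].
  by rewrite mulrDr -scalerAr tensDl tensZl.
by rewrite tensDr tensZr.
Qed.

(** * The canonical map and the translation map *)

Section HopfGaloisExtension.
Variables (k : fieldType) (H : hopfAlgType k) (A : algType k).
Variable delta : {linear A -> (A ⊗ H)%type}.
Hypothesis hg : Hopf_Galois delta.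

Let deltaM : {morph delta : a b / a * b}.
Proof. by case: hg => -[_ _ []]. Qed.

Let delta1 : delta 1 = 1 ⊗ 1.
Proof. by case: hg => -[_ _ []]. Qed.

(** Balancedness is (a b) ⊗ 1 = (a ⊗ 1) * (b ⊗ 1) followed by
    (b ⊗ 1) * delta a' = delta (b a'), as b ⊗ 1 = delta b. *)
Lemma canonical_map_balanced :
  balanced_bilinear (fun (b : coinvariant delta) (a : A) => a * val b)
    (fun (b : coinvariant delta) (a : A) => val b * a)
    (fun a a' => tlift (fun a'0 a'1 => (a * a'0) ⊗ a'1 : (A ⊗ H)%type) (delta a')).
Proof.
split=> [a' c u v|a c u v|b a a'].
- rewrite /tlift scaler_sumr -big_split; apply: eq_bigr => p _ /=.
  by rewrite mulrDl -scalerAl tensDl tensZl.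
- by rewrite !tlift_mull linearP tens1_mul_linear.
- rewrite !tlift_mull deltaM (set_mem (valP b)) mulrA; congr (_ * _).
  by rewrite [RHS]tmulE mulr1.
Qed.

Lemma canonical_map_tens (p q : A) :
  canonical_map (tens p q : tensorB delta) = (p ⊗ 1) * delta q.
Proof. by rewrite /canonical_map (tliftE _ _ canonical_map_balanced) tlift_mull. Qed.

Lemma canonical_map_linear : linear (@canonical_map k H A delta).
Proof. exact: tlift_linear canonical_map_balanced. Qed.

Lemma canonical_map_inj : injective (@canonical_map k H A delta).
Proof. by case: hg => _ /bij_inj. Qed.

Lemma translation_mapK (h : H) :
  canonical_map (translation_map delta h) = 1 ⊗ h.
Proof.
case: hg => _ [g _ gK]; apply: pinvK.
by apply/mem_set; exists (g (1 ⊗ h)).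
Qed.

Lemma translation_map_sum (h : H) :
  \sum_(u <- repr (translation_map delta h)) (u.1 ⊗ 1) * delta u.2 = 1 ⊗ h.
Proof.
rewrite -translation_mapK {2}(tensE (translation_map delta h)).
rewrite (linear_fun_sum _ _ canonical_map_linear).
by apply: eq_bigr => u _; rewrite canonical_map_tens.
Qed.

Lemma translation_map_linear : linear (@translation_map k H A delta).
Proof.
move=> c x y; apply: canonical_map_inj.
by rewrite canonical_map_linear !translation_mapK tensDr tensZr.
Qed.

Lemma translation_map1 : translation_map delta 1 = tens 1 1.
Proof.
apply: canonical_map_inj.
by rewrite translation_mapK canonical_map_tens delta1 [RHS]tmulE !mul1r.
Qed.

(** Apply chi, which sends the summand at u, v to
    (u1 ⊗ 1) * ((v1 ⊗ 1) * delta v2) * delta u2; the inner factors sum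
    to 1 ⊗ h over v, this commutes with u1 ⊗ 1, and the remaining factors sum
    to 1 ⊗ g over u. *)
Lemma translation_mapM (h g : H) :
  translation_map delta (h * g) =
  \sum_(u <- repr (translation_map delta g))
    \sum_(v <- repr (translation_map delta h)) tens (u.1 * v.1) (v.2 * u.2).
Proof.
apply: canonical_map_inj; rewrite translation_mapK.
rewrite (linear_fun_sum _ _ canonical_map_linear).
transitivity (\sum_(u <- repr (translation_map delta g))
   (u.1 ⊗ 1) * (1 ⊗ h) * delta u.2 : (A ⊗ H)%type).
  transitivity ((1 ⊗ h) * (1 ⊗ g) : (A ⊗ H)%type).
    by rewrite [RHS]tmulE mulr1.
  rewrite -(translation_map_sum g) mulr_sumr; apply: eq_bigr => u _.
  rewrite mulrA; congr (_ * _).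
  by rewrite [LHS]tmulE [RHS]tmulE !mul1r !mulr1.
apply: eq_bigr => u _; rewrite (linear_fun_sum _ _ canonical_map_linear).
rewrite -(translation_map_sum h) mulr_sumr mulr_suml; apply: eq_bigr => v _.
rewrite canonical_map_tens deltaM !mulrA; congr (_ * _ * _).
by rewrite [LHS]tmulE mulr1.
Qed.

(** * The braided right action *)

Lemma translation_integrand_balanced (X : Endk A) (c : A) : EndB delta X ->
  balanced_bilinear (fun (b : coinvariant delta) (a : A) => a * val b)
    (fun (b : coinvariant delta) (a : A) => val b * a)
    (fun p q => X (c * p) * q).
Proof.
move=> XB; split=> [q d u v|p d u v|b p q].
- by rewrite mulrDr -scalerAr linearP mulrDl -scalerAl.
- by rewrite mulrDr -scalerAr.
- by rewrite mulrA XB ?mulrA//; exact: set_mem (valP b).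
Qed.

Lemma braided_integrand_bilinear (X : Endk A) (z : A) : EndB delta X ->
  balanced_bilinear (fun c (m : A) => c *: m) (fun c (n : H) => c *: n)
    (fun a0 a1 => tlift (fun p q => X (a0 * z * p) * q)
                    (translation_map delta a1)).
Proof.
move=> XB; apply: bilinear_balanced => [h c u v|a c u v].
  rewrite /tlift scaler_sumr -big_split; apply: eq_bigr => p _ /=.
  by rewrite !mulrDl -!scalerAl linearP mulrDl -scalerAl.
rewrite translation_map_linear.
exact: tlift_linear (translation_integrand_balanced _ XB) _ _ _.
Qed.

Lemma braided_ract1 (X : Endk A) (z : A) :
  EndB delta X -> braided_ract delta X 1 z = X z.
Proof.
move=> XB; rewrite /braided_ract delta1.
rewrite (tliftE _ _ (braided_integrand_bilinear z XB)) translation_map1.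
by rewrite (tliftE _ _ (translation_integrand_balanced _ XB)) mul1r !mulr1.
Qed.

(** Both sides are the sum of X (a_0 b_0 z b^<1> a^<1>) a^<2> b^<2>, where
    a^<1> ⊗ a^<2> = tau a_1 and b^<1> ⊗ b^<2> = tau b_1: on the left
    because tau (a_1 b_1) = b^<1> a^<1> ⊗ a^<2> b^<2>, on the right because
    the inner action of a is evaluated at b_0 z b^<1>. *)
Lemma braided_ractM (X : Endk A) (a b z : A) : EndB delta X ->
  braided_ract delta X (a * b) z =
  braided_ract delta (braided_ract delta X a) b z.
Proof.
move=> XB; rewrite {1}/braided_ract deltaM.
rewrite (tlift_mul _ _ (braided_integrand_bilinear z XB)).
rewrite {1}/tlift [LHS]exchange_big; apply: eq_bigr => y _ /=.
rewrite [RHS]/tlift; under [RHS]eq_bigr do rewrite /braided_ract /tlift mulr_suml.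
rewrite exchange_big; apply: eq_bigr => x _ /=.
have XL := tlift_linear (translation_integrand_balanced (x.1 * y.1 * z) XB).
rewrite translation_mapM (linear_fun_sum _ _ XL); apply: eq_bigr => u _.
rewrite (linear_fun_sum _ _ XL) mulr_suml; apply: eq_bigr => v _.
by rewrite (tliftE _ _ (translation_integrand_balanced _ XB)) !mulrA.
Qed.

Lemma braided_ract_scale (X : A -> A) (a b z : A) :
  braided_ract delta (fun a' => a * X a') b z = a * braided_ract delta X b z.
Proof.
rewrite /braided_ract /tlift mulr_sumr; apply: eq_bigr => p _.
by rewrite mulr_sumr; apply: eq_bigr => q _; rewrite mulrA.
Qed.

(** * The bimodule of braided vector fields *)

Lemma Xsigma_setP (X : Xsigma delta) : Xsigma_set delta (val X).
Proof. exact: set_mem (valP X). Qed.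

(** The right action no longer involves delta or tau once X is known to be a
    braided vector field. *)
Lemma braided_ractE (X : Xsigma delta) (a z : A) :
  braided_ract delta (val X) a z = val X (a * z) - val X a * z.
Proof. by have [_ ->] := Xsigma_setP X; rewrite addrC addKr. Qed.

Lemma Endk_lact_linear (X : Endk A) (a : A) : linear (fun z => a * X z).
Proof. by move=> c u v; rewrite linearP mulrDr -scalerAr. Qed.

Definition Endk_lact (a : A) (X : Endk A) : Endk A :=
  HB.pack_for {linear A -> A} (fun z => a * X z)
    (GRing.isLinear.Build k A A _ (fun z => a * X z) (Endk_lact_linear X a)).

Lemma Xsigma_lact_subproof (a : A) (X : Xsigma delta) :
  Endk_lact a (val X) \in Xsigma_pred delta.
Proof.
have [XB XL] := Xsigma_setP X; apply/mem_set; split=> [b c cB|b c] /=.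
  by rewrite XB// mulrA.
by rewrite braided_ract_scale -mulrA -mulrDr -XL.
Qed.

Definition Xsigma_lact (a : A) (X : Xsigma delta) : Xsigma delta :=
  Sub (Endk_lact a (val X)) (Xsigma_lact_subproof a X).

Lemma Endk_ract_linear (X : Endk A) (a : A) :
  linear (fun z => X (a * z) - X a * z).
Proof.
move=> c u v.
by rewrite !mulrDr -!scalerAr linearP scalerBr opprD addrACA.
Qed.

(** By [braided_ractE] this is the braided right action on braided vector
    fields; the difference formula is k-linear for every endomorphism X. *)
Definition Endk_ract (X : Endk A) (a : A) : Endk A :=
  HB.pack_for {linear A -> A} (fun z => X (a * z) - X a * z)
    (GRing.isLinear.Build k A A _ (fun z => X (a * z) - X a * z)
       (Endk_ract_linear X a)).

Lemma Xsigma_ract_subproof (X : Xsigma delta) (a : A) :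
  Endk_ract (val X) a \in Xsigma_pred delta.
Proof.
have [XB XL] := Xsigma_setP X; apply/mem_set; split=> [b c cB|b c] /=.
  by rewrite mulrA XB// mulrBl !mulrA.
(* The outer action must stay in braided form, where it composes; the inner
   one is replaced by the braided formula too, and only the action of the
   product a * b is turned back into a difference. *)
have -> : (fun z => val X (a * z) - val X a * z) =
    braided_ract delta (val X) a.
  by apply: funext => z; rewrite braided_ractE.
rewrite -braided_ractM// braided_ractE !mulrA mulrBl.
by rewrite [RHS]addrC subrKA.
Qed.

Definition Xsigma_ract (X : Xsigma delta) (a : A) : Xsigma delta :=
  Sub (Endk_ract (val X) a) (Xsigma_ract_subproof X a).

Lemma Xsigma_eq (X Y : Xsigma delta) : (forall z, val X z = val Y z) -> X = Y.
Proof. by move=> XY; apply/val_inj/Endk_eqP. Qed.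

Lemma Xsigma1 (X : Xsigma delta) : val X 1 = 0.
Proof.
have [XB _] := Xsigma_setP X.
have := braided_ractE X 1 1; rewrite braided_ract1// !mulr1.
by rewrite subrr.
Qed.

Lemma Xsigma_bimodule : is_bimodule Xsigma_lact Xsigma_ract.
Proof.
split.
- by move=> X c a b; apply: Xsigma_eq => z /=; rewrite mulrDl -scalerAl.
- by move=> a c X Y; apply: Xsigma_eq => z /=; rewrite mulrDr -scalerAr.
- by move=> a b X; apply: Xsigma_eq => z /=; rewrite mulrA.
- by move=> X; apply: Xsigma_eq => z /=; rewrite mul1r.
- move=> a c X Y; apply: Xsigma_eq => z /=.
  by rewrite mulrDl -scalerAl scalerBr opprD addrACA.
- move=> X c a b; apply: Xsigma_eq => z /=.
  by rewrite mulrDl -scalerAl !linearP mulrDl -scalerAl scalerBr opprD addrACA.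
- move=> X a b; apply: Xsigma_eq => z /=.
  by rewrite mulrBl !mulrA opprB addrA subrK.
- by move=> X; apply: Xsigma_eq => z /=; rewrite Xsigma1 mul1r mul0r subr0.
- by move=> a X b; apply: Xsigma_eq => z /=; rewrite mulrBr mulrA.
Qed.

End HopfGaloisExtension.

Theorem theorem2p18 (k : fieldType) (H : hopfAlgType k) (A : algType k)
    (delta : {linear A -> (A ⊗ H)%type}) (hg : Hopf_Galois delta) :
  exists (lact : A -> Xsigma delta -> Xsigma delta)
         (ract : Xsigma delta -> A -> Xsigma delta),
    [/\ forall a X a', Xsigma_incl (lact a X) a' = a * Xsigma_incl X a',
        forall X a a',
          Xsigma_incl (ract X a) a' = braided_ract delta (Xsigma_incl X) a a'
      & is_FOVC lact ract (@Xsigma_incl k H A delta)].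
Proof.
exists (@Xsigma_lact k H A delta), (Xsigma_ract hg); split=> //.
  by move=> X a a'; rewrite braided_ractE.
split=> //.
- exact: Xsigma_bimodule.
- by move=> X a b; rewrite addrC subrK.
Qed.
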